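(* Let $z\in\mathbb{C}\setminus\{0\}$. Then for each integer $n\ge 0$, $$G_n(z)=z^{\frac n2}\,S_n\!\left(\frac{1}{\sqrt z}\right)=z^{\frac n2}\,U_n\!\left(\frac{1}{2\sqrt z}\right).$$
   Context: The polynomials $G_n$ are defined for $z\in\mathbb{C}$ by $G_0(z)=G_1(z)=1$ and $G_n(z)=G_{n-1}(z)-zG_{n-2}(z)$ for $n\ge 2$. $U_n$ is the Chebyshev polynomial of the second kind: $U_n(x)=\frac{\sin((n+1)\arccos x)}{\sin(\arccos x)}$ for $x\in(-1,1)$, extended as a polynomial to $\mathbb{C}$. $S_n(x)=U_n(x/2)$ for $x\in\mathbb{C}$. Here $\sqrt z$ denotes a fixed square root of $z$ and $z^{n/2}$ means $(\sqrt z)^n$ for the same square root. *)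

(* Defs.v *)
From HB Require Import structures.
From mathcomp Require Import all_boot all_order all_algebra.
From mathcomp Require Import boolp reals trigo.
From mathcomp Require Import complex ring lra.

Set Implicit Arguments.
Unset Strict Implicit.
Unset Printing Implicit Defensive.

Import Order.TTheory GRing.Theory Num.Theory.
Local Open Scope ring_scope.
Local Open Scope complex_scope.

Fixpoint polyG (R : realType) (n : nat) (z : R[i]) : R[i] :=
  match n with
  | 0 => 1
  | n1.+1 => match n1 with
             | 0 => 1
             | n2.+1 => polyG n1 z - z * polyG n2 z
             end
  end.

(* The trigonometric formula on ]-1, 1[ determines U_n as a complex polynomial,
   by the existence and uniqueness lemmas below. *)
Definition is_chebyshevU (R : realType) (n : nat) (p : {poly R[i]}) : Prop :=
  forall x : R, -1 < x < 1 ->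
    p.[x%:C] = (sin (n.+1%:R * acos x) / sin (acos x))%:C.

Lemma is_chebyshevU_exists (R : realType) (n : nat) :
  exists p : {poly R[i]}, is_chebyshevU n p.
Proof.
suff [p [_ [hp _]]] : exists p q : {poly R[i]},
  is_chebyshevU n p /\ is_chebyshevU n.+1 q by exists p.
have sin_neq0 (x : R) : -1 < x < 1 -> sin (acos x) != 0.
  by move=> x1; rewrite gt_eqF// sin_gt0_pi// acos_gt0 ?acos_ltpi; lra.
have cosK (x : R) : -1 < x < 1 -> cos (acos x) = x.
  by move=> x1; rewrite acosK// in_itv/=; lra.
elim: n => [|n [p [q [hp hq]]]].
  exists 1, (2%:R *: 'X); split => x x1.
    by rewrite hornerC mul1r divff ?sin_neq0.
  have -> : 2%:R * acos x = acos x + acos x by ring.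
  rewrite hornerZ hornerX sinD cosK// -(rmorph_nat (@real_complex R)) -rmorphM.
  by congr (_%:C); field; exact: sin_neq0.
exists q, (2%:R *: 'X * q - p); split => // x x1.
rewrite hornerD hornerN hornerM hornerZ hornerX hp// hq//.
rewrite -(rmorph_nat (@real_complex R)) -!rmorphM -rmorphB; congr (_%:C).
set a := acos x.
have -> : n.+3%:R * a = n.+2%:R * a + a by rewrite -(natr1 n.+2); ring.
have -> : n.+1%:R * a = n.+2%:R * a - a by rewrite -(natr1 n.+1); ring.
rewrite sinB sinD cosK//; field; exact: sin_neq0.
Qed.

Lemma is_chebyshevU_unique (R : realType) (n : nat) (p q : {poly R[i]}) :
  is_chebyshevU n p -> is_chebyshevU n q -> p = q.
Proof.
move=> hp hq; apply/eqP; rewrite -subr_eq0; apply/negPn/negP => nz.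
pose s := [seq (k.+2%:R^-1 : R)%:C | k <- iota 0 (size (p - q))].
have us : uniq s.
  rewrite map_inj_uniq ?iota_uniq// => i j /complexI /invr_inj /eqP.
  by rewrite eqr_nat => /eqP [].
have rs : all (root (p - q)) s.
  apply/allP => _ /mapP [k _ ->].
  have h : -1 < (k.+2%:R^-1 : R) < 1.
    apply/andP; split; last by rewrite invf_lt1 ?ltr0n// ltr1n.
    by apply: (@lt_trans _ _ 0); rewrite ?oppr_lt0 ?invr_gt0 ?ltr0n.
  by rewrite /root hornerD hornerN hp// hq// subrr.
by have := max_poly_roots nz rs us; rewrite size_map size_iota ltnn.
Qed.

Definition polyU (R : realType) (n : nat) : {poly R[i]} :=
  projT1 (cid (is_chebyshevU_exists R n)).

Definition chebyshevU (R : realType) (n : nat) (x : R[i]) : R[i] :=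
  (polyU R n).[x].

Definition chebyshevS (R : realType) (n : nat) (x : R[i]) : R[i] :=
  chebyshevU n (x / 2%:R).

(* Main.v *)
(* The addition formulas for the sine give U_(n+2) = 2x U_(n+1) - U_n on ]-1, 1[,
   hence as polynomials; at x = 1 / (2w), multiplying by w^(n+2) turns this into
   the recurrence defining G_n at z = w^2. *)
Require Import Defs.
From mathcomp Require Import all_boot all_order all_algebra.
From mathcomp Require Import boolp reals trigo.
From mathcomp Require Import complex ring lra.

Import Order.TTheory GRing.Theory Num.Theory.
Local Open Scope ring_scope.
Local Open Scope complex_scope.

(** [polyU] is an opaque choice; it is computed only through this property and
    [is_chebyshevU_unique]. *)
Lemma polyUP (R : realType) (n : nat) : is_chebyshevU n (polyU R n).
Proof. exact: (projT2 (cid (is_chebyshevU_exists R n))). Qed.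

Lemma sin_acos_neq0 (R : realType) (x : R) : -1 < x < 1 -> sin (acos x) != 0.
Proof. by move=> x1; rewrite gt_eqF// sin_gt0_pi// acos_gt0 ?acos_ltpi; lra. Qed.

Lemma polyU0 (R : realType) : polyU R 0 = 1.
Proof.
apply: is_chebyshevU_unique (polyUP R 0) _ => x x1.
by rewrite hornerC mul1r divff ?sin_acos_neq0.
Qed.

(** Expand the sines of (n+1)a + a and (n+1)a - a: the terms in sin a cancel in the sum. *)
Lemma sin_three_term (R : realType) (n : nat) (a : R) :
  sin (n.+2%:R * a) = 2%:R * cos a * sin (n.+1%:R * a) - sin (n%:R * a).
Proof.
have -> : n.+2%:R * a = n.+1%:R * a + a by rewrite -(natr1 n.+1); ring.
have -> : n%:R * a = n.+1%:R * a - a by rewrite -(natr1 n); ring.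
by rewrite sinB sinD; ring.
Qed.

Lemma polyU1 (R : realType) : polyU R 1 = 2%:R *: 'X.
Proof.
apply: is_chebyshevU_unique (polyUP R 1) _ => x x1.
(* At n = 0 the three-term relation is the double-angle formula. *)
rewrite hornerZ hornerX sin_three_term mul0r sin0 subr0 mul1r.
rewrite acosK ?in_itv/=; last lra.
by rewrite mulfK ?sin_acos_neq0// rmorphM rmorph_nat.
Qed.

Lemma polyU_rec (R : realType) (n : nat) :
  polyU R n.+2 = 2%:R *: 'X * polyU R n.+1 - polyU R n.
Proof.
apply: is_chebyshevU_unique (polyUP R n.+2) _ => x x1.
rewrite hornerD hornerN hornerM hornerZ hornerX !polyUP//.
rewrite -(rmorph_nat (@real_complex R)) -!rmorphM -rmorphB; congr (_%:C).
rewrite (sin_three_term R n.+1) acosK ?in_itv/=; last lra.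
by ring.
Qed.

Lemma polyG_chebyshevU (R : realType) (w : R[i]) (n : nat) : w != 0 ->
  polyG n (w ^+ 2) = w ^+ n * chebyshevU n (1 / (2%:R * w)).
Proof.
move=> w0; rewrite /chebyshevU.
(* The recurrence has order two, so the induction carries two consecutive indices. *)
suff [] : polyG n (w ^+ 2) = w ^+ n * (polyU R n).[1 / (2%:R * w)] /\
  polyG n.+1 (w ^+ 2) = w ^+ n.+1 * (polyU R n.+1).[1 / (2%:R * w)] by [].
elim: n => [|n [IHn IHn1]].
  by rewrite polyU0 polyU1 hornerC hornerZ hornerX /=; split; [ring | field].
split=> //; rewrite [LHS]/= -/(polyG n.+1 _) IHn IHn1.
(* At x = 1/(2w), 2x w^(n+2) = w^(n+1), so the right side is w^(n+1) U_(n+1)(x) - w^2 w^n U_n(x). *)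
rewrite polyU_rec hornerD hornerN hornerM hornerZ hornerX !exprS.
by field.
Qed.

(* w is an arbitrary square root of z; z^(n/2) is w ^+ n. *)
Theorem theorem1 (R : realType) (z : R[i]) (hz : z != 0)
    (w : R[i]) (hw : w ^+ 2 = z) (n : nat) :
  polyG n z = w ^+ n * chebyshevS n (1 / w) /\
  w ^+ n * chebyshevS n (1 / w) = w ^+ n * chebyshevU n (1 / (2%:R * w)).
Proof.
have w0 : w != 0 by move: hz; rewrite -hw expf_eq0.
have SU : chebyshevS n (1 / w) = chebyshevU n (1 / (2%:R * w)).
  by rewrite /chebyshevS; congr chebyshevU; field.
by rewrite SU -hw polyG_chebyshevU.
Qed.
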